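(* There exists a one-parameter family $(\mathcal{H}_{K})_{K \in ]-1,1[ \setminus \{0\}}$ of properly embedded minimal helicoids in $\mathrm{Sol}_3$ having the following properties: 1. for all $K \in ]-1,1[ \setminus \{0\}$, the surface $\mathcal{H}_K$ contains the $x_3$-axis; 2. for all $K \in ]-1,1[ \setminus \{0\}$, the intersection of $\mathcal{H}_K$ with any horizontal plane $\{x_3=\lambda\}$, $\lambda\in\mathbb{R}$, is a straight line; 3. for all $K \in ]-1,1[ \setminus \{0\}$, there exists $T_K$ such that $\mathcal{H}_K$ is invariant by left multiplication by $(0,0,T_K)$; 4. for all $K \in ]-1,1[ \setminus \{0\}$, the helicoid $\mathcal{H}_K$ has the following 3 symmetries fixing the origin (i.e. it is invariant under the following isometries of $\mathrm{Sol}_3$): the rotation of angle $\pi$ around the $x_3$-axis, $(x_1,x_2,x_3)\mapsto(-x_1,-x_2,x_3)$; the rotation of angle $\pi$ around the axis $\{(x,x,0)\mid x\in\mathbb{R}\}$, $(x_1,x_2,x_3)\mapsto(x_2,x_1,-x_3)$; the rotation of angle $\pi$ around the axis $\{(x,-x,0)\mid x\in\mathbb{R}\}$, $(x_1,x_2,x_3)\mapsto(-x_2,-x_1,-x_3)$.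
   Context: $\mathrm{Sol}_3$ is the Lie group $\mathbb{R}^3$ with multiplication $(x_1,x_2,x_3)\ast(y_1,y_2,y_3)=(y_1e^{-x_3}+x_1,\;y_2e^{x_3}+x_2,\;x_3+y_3)$, endowed with the left-invariant Riemannian metric $ds^2=e^{2x_3}dx_1^2+e^{-2x_3}dx_2^2+dx_3^2$. Minimal means zero mean curvature for this metric. A helicoid in $\mathrm{Sol}_3$ is a minimal surface containing the $x_3$-axis, whose intersection with every plane $\{x_3=\text{const}\}$ is a straight line (in the coordinates of $\mathbb{R}^3$), and which is invariant by left multiplication by an element of the form $(0,0,T)$ for some $T\neq0$. *)

(* Defs.v *)
From Stdlib Require Import Reals List.
From Coquelicot Require Import Coquelicot.
Open Scope R_scope.

Definition point : Type := (R * R * R)%type.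

Inductive axis : Set := ax1 | ax2 | ax3.

Definition coord (i : axis) (p : point) : R :=
  match p, i with
  | (x1, _, _), ax1 => x1
  | (_, x2, _), ax2 => x2
  | (_, _, x3), ax3 => x3
  end.

Definition set_coord (i : axis) (t : R) (p : point) : point :=
  match p, i with
  | (_, x2, x3), ax1 => (t, x2, x3)
  | (x1, _, x3), ax2 => (x1, t, x3)
  | (x1, x2, _), ax3 => (x1, x2, t)
  end.

Definition sum3 (f : axis -> R) : R := f ax1 + f ax2 + f ax3.

Definition partial (i : axis) (f : point -> R) (p : point) : R :=
  Derive (fun t => f (set_coord i t p)) (coord i p).

(** * The group and the metric *)

Definition sol_mul (x y : point) : point :=
  match x, y with
  | (x1, x2, x3), (y1, y2, y3) =>
      (y1 * exp (- x3) + x1, y2 * exp x3 + x2, x3 + y3)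
  end.

Definition sol_metric (i j : axis) (p : point) : R :=
  match i, j with
  | ax1, ax1 => exp (2 * coord ax3 p)
  | ax2, ax2 => exp (- (2 * coord ax3 p))
  | ax3, ax3 => 1
  | _, _ => 0
  end.

(* Tangent vectors are given by their components in the coordinate frame. *)
Definition inner (p : point) (v w : axis -> R) : R :=
  sum3 (fun i => sum3 (fun j => sol_metric i j p * v i * w j)).

(* Christoffel symbols of the first kind of the Levi-Civita connection:
   the inner product of nabla_(d_i) d_j with d_l. *)
Definition christoffel (i j l : axis) (p : point) : R :=
  (partial i (sol_metric j l) p + partial j (sol_metric i l) p
   - partial l (sol_metric i j) p) / 2.

(** * Parametrized surfaces *)

Definition Du (f : R * R -> R) (q : R * R) : R :=
  Derive (fun t => f (t, snd q)) (fst q).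

Definition Dv (f : R * R -> R) (q : R * R) : R :=
  Derive (fun t => f (fst q, t)) (snd q).

Fixpoint Ck_on (n : nat) (V : R * R -> Prop) (f : R * R -> R) : Prop :=
  match n with
  | O => forall q, V q -> continuous f q
  | S m =>
      (forall q, V q -> ex_derive (fun t => f (t, snd q)) (fst q)) /\
      (forall q, V q -> ex_derive (fun t => f (fst q, t)) (snd q)) /\
      Ck_on m V (Du f) /\ Ck_on m V (Dv f)
  end.

Definition smooth_on (V : R * R -> Prop) (X : R * R -> point) : Prop :=
  forall (n : nat) (i : axis), Ck_on n V (fun q => coord i (X q)).

(* [D] is meant to be [Du] or [Dv]. *)
Definition tangent (D : (R * R -> R) -> R * R -> R) (X : R * R -> point)
    (q : R * R) : axis -> R :=
  fun i => D (fun r => coord i (X r)) q.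

Definition immersed_at (X : R * R -> point) (q : R * R) : Prop :=
  forall a b : R,
    (forall i, a * tangent Du X q i + b * tangent Dv X q i = 0) ->
    a = 0 /\ b = 0.

Definition unit_normal (X : R * R -> point) (q : R * R) (n : axis -> R) : Prop :=
  inner (X q) n (tangent Du X q) = 0 /\
  inner (X q) n (tangent Dv X q) = 0 /\
  inner (X q) n n = 1.

Definition first_form (D D' : (R * R -> R) -> R * R -> R)
    (X : R * R -> point) (q : R * R) : R :=
  inner (X q) (tangent D X q) (tangent D' X q).

(* The inner product of nabla_(D X) (D' X) with [n], where nabla is the
   Levi-Civita connection of [sol_metric]. *)
Definition second_form (D D' : (R * R -> R) -> R * R -> R)
    (X : R * R -> point) (q : R * R) (n : axis -> R) : R :=
  inner (X q) (fun k => D (D' (fun r => coord k (X r))) q) n +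
  sum3 (fun l => sum3 (fun i => sum3 (fun j =>
    christoffel i j l (X q) * tangent D X q i * tangent D' X q j * n l))).

Definition mean_curvature (X : R * R -> point) (q : R * R) (n : axis -> R) : R :=
  (second_form Du Du X q n * first_form Dv Dv X q
   - 2 * second_form Du Dv X q n * first_form Du Dv X q
   + second_form Dv Dv X q n * first_form Du Du X q)
  / (2 * (first_form Du Du X q * first_form Dv Dv X q
          - first_form Du Dv X q ^ 2)).

(** * Embedded surfaces as subsets of the ambient space *)

(* [X], restricted to [V], is a smooth immersion and a homeomorphism onto the
   relatively open subset [S] intersected with [U], with inverse [Y]. *)
Definition chart (S : point -> Prop) (V : R * R -> Prop) (X : R * R -> point)
    : Prop :=
  open V /\ smooth_on V X /\ (forall q, V q -> immersed_at X q) /\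
  exists (U : point -> Prop) (Y : point -> R * R),
    open U /\
    (forall p, (S p /\ U p) <-> exists q, V q /\ X q = p) /\
    (forall q, V q -> Y (X q) = q) /\
    (forall p, S p -> U p -> filterlim Y (within S (locally p)) (locally (Y p))).

Definition embedded_surface (S : point -> Prop) : Prop :=
  forall p, S p -> exists V X q, chart S V X /\ V q /\ X q = p.

Definition compact_set {T : UniformSpace} (C : T -> Prop) : Prop :=
  forall (I : Type) (D : I -> T -> Prop),
    (forall i, open (D i)) ->
    (forall x, C x -> exists i, D i x) ->
    exists l : list I, forall x, C x -> exists i, In i l /\ D i x.

(* The second conjunct says that the inclusion of [S] is a proper map. *)
Definition properly_embedded_surface (S : point -> Prop) : Prop :=
  embedded_surface S /\
  forall C : point -> Prop, compact_set C -> compact_set (fun p => S p /\ C p).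

(* The value [h] does not depend on the chart, and changes sign with the unit
   normal. *)
Definition has_mean_curvature (S : point -> Prop) (p : point) (h : R) : Prop :=
  exists V X q n,
    chart S V X /\ V q /\ X q = p /\ unit_normal X q n /\
    mean_curvature X q n = h.

Definition minimal_surface (S : point -> Prop) : Prop :=
  embedded_surface S /\ forall p, S p -> has_mean_curvature S p 0.

(** * Helicoids *)

Definition contains_x3_axis (S : point -> Prop) : Prop :=
  forall t : R, S (0, 0, t).

Definition straight_line (L : point -> Prop) : Prop :=
  exists (a d : point), d <> (0, 0, 0) /\
    forall p, L p <->
      exists s : R, forall i, coord i p = coord i a + s * coord i d.

Definition horizontal_slices_are_lines (S : point -> Prop) : Prop :=
  forall lambda : R, straight_line (fun p => S p /\ coord ax3 p = lambda).

Definition invariant_under (f : point -> point) (S : point -> Prop) : Prop :=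
  forall p, S p <-> exists p0, S p0 /\ f p0 = p.

Definition helicoid (S : point -> Prop) : Prop :=
  minimal_surface S /\
  contains_x3_axis S /\
  horizontal_slices_are_lines S /\
  exists T : R, T <> 0 /\ invariant_under (sol_mul (0, 0, T)) S.

Definition rotation_x3_axis (p : point) : point :=
  match p with (x1, x2, x3) => (- x1, - x2, x3) end.

(* Rotation of angle pi around the axis of the points (x, x, 0). *)
Definition rotation_diagonal (p : point) : point :=
  match p with (x1, x2, x3) => (x2, x1, - x3) end.

(* Rotation of angle pi around the axis of the points (x, -x, 0). *)
Definition rotation_antidiagonal (p : point) : point :=
  match p with (x1, x2, x3) => (- x2, - x1, - x3) end.

(* Main.v *)
Require Import Defs.
From Stdlib Require Import Reals List.
From Coquelicot Require Import Coquelicot.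
From Stdlib Require Import Lra FunctionalExtensionality Classical.
Open Scope R_scope.

(** The frame [e^(-x3) d_1, e^(x3) d_2, d_3] is orthonormal and left invariant.
    A surface through the [x3]-axis with horizontal rulings is described by the
    angle [v(z)] that its ruling at height [z] makes with the first vector of
    this frame, the ruling being directed by [(e^(-z) cos v, e^z sin v, 0)].
    Expanding the mean curvature in powers of the position on the ruling, the
    cubic terms cancel and the linear ones leave
      [v'' = - cos (2 v) (3 v' + sin (2 v))].
    With [w = v' + sin (2 v)], this equation has the first integral
    [(2 w - sin (2 v)) / w^2 = K], and solving for [v'] on the branch on which
    it never vanishes gives
      [v' = rho (1 + rho) / K],  [rho = sqrt (1 - K sin (2 v))].
    For [0 < |K| < 1] the right-hand side is smooth, [PI]-periodic in [v] and
    bounded away from [0] and from infinity.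

    It is convenient to use [v] itself as a parameter and to regard [z] as the
    unknown: then [z] is the primitive [height] of the explicit function
    [pitch = K / (rho (1 + rho))], and the surface is the image of
      [patch (u, v) = (u e^(-z) cos v, u e^z sin v, z)],  [z = height v].
    The equation above becomes a formula for the derivative of [pitch]
    ([is_derive_pitch]), which yields both the smoothness of [patch] (sums of
    products of [sin], [cos], [pitch], [height] and exponentials of [height] are
    stable under differentiation, [pa_derive]) and its minimality
    ([patch_minimal]).

    Since [pitch] is bounded away from zero, [height] is a homeomorphism of the
    line ([height_inverse]). So [patch] is a single global chart
    ([patch_chart]), the surface is the zero set of a continuous function, hence
    closed and properly embedded, and every horizontal plane meets it in exactly
    one ruling.

    The symmetries come from those of [sin (2 v)]: invariance under
    [v |-> v + PI] gives the translation, and invariance under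
    [v |-> PI / 2 - v], together with [height (PI / 4) = 0], gives the half-turns
    about the two horizontal lines. Finally the surface determines [height] near
    [PI / 4], and the slope [1 / sqrt (1 - K) - 1] of [height] at that point
    determines [K] ([helicoid_surface_injective]). *)

(** * Functions on the line with derivative bounded away from zero *)

(** The constant [c] lets increasing and decreasing functions be treated at
    once: only the product of [c] with the derivative has a known sign. *)
Lemma expanding (f df : R -> R) (c m : R) :
  (forall x, is_derive f x (df x)) ->
  (forall x, m <= c * df x) ->
  forall x y, x <= y -> m * (y - x) <= c * (f y - f x).
Proof.
  intros Hf Hm x y Hxy.
  destruct (MVT_gen f x y df) as [z [_ Hz]].
  - intros t _; apply Hf.
  - intros t _; apply continuity_pt_filterlim.
    apply (ex_derive_continuous (K := R_AbsRing) (V := R_NormedModule)).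
    exists (df t); apply Hf.
  - rewrite Hz, <- Rmult_assoc. apply Rmult_le_compat_r; [lra | apply Hm].
Qed.

Lemma expanding_abs (f df : R -> R) (c m : R) :
  (forall x, is_derive f x (df x)) ->
  (forall x, m <= c * df x) ->
  forall x y, m * Rabs (y - x) <= Rabs c * Rabs (f y - f x).
Proof.
  intros Hf Hm.
  assert (Hle : forall x y, x <= y ->
            m * Rabs (y - x) <= Rabs c * Rabs (f y - f x)).
  { intros x y Hxy. rewrite <- Rabs_mult, (Rabs_pos_eq (y - x)) by lra.
    eapply Rle_trans; [apply (expanding f df c m Hf Hm x y Hxy) | apply Rle_abs]. }
  intros x y. destruct (Rle_dec x y) as [Hxy | Hxy]; [now apply Hle |].
  rewrite (Rabs_minus_sym y x), (Rabs_minus_sym (f y)). apply Hle; lra.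
Qed.

Lemma expanding_surjective (f df : R -> R) (c m : R) :
  0 < m ->
  (forall x, is_derive f x (df x)) ->
  (forall x, m <= c * df x) ->
  forall y, { x | f x = y }.
Proof.
  intros Hm0 Hf Hm y.
  assert (Hc : c <> 0).
  { intros ->. specialize (Hm 0). lra. }
  (* On [-b, b] the values of [c * f] move away from [c * f 0] by at least
     [m * b], which is the distance to the target. *)
  set (b := Rabs (c * (y - f 0)) / m).
  assert (Hb : m * b = Rabs (c * (y - f 0))) by (unfold b; field; lra).
  assert (Hb0 : 0 <= b).
  { unfold b. apply Rmult_le_pos; [apply Rabs_pos |].
    left; now apply Rinv_0_lt_compat. }
  assert (Hr := expanding f df c m Hf Hm 0 b Hb0).
  assert (Hl := expanding f df c m Hf Hm (- b) 0 ltac:(lra)).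
  assert (H1 := Rle_abs (c * (y - f 0))).
  assert (H2 := Rle_abs (- (c * (y - f 0)))). rewrite Rabs_Ropp in H2.
  destruct (IVT_gen (fun x => c * f x) (- b) b (c * y)) as [x [_ Hx]].
  - intros t. apply continuity_pt_filterlim.
    apply (ex_derive_continuous (K := R_AbsRing) (V := R_NormedModule)
             (fun x => c * f x)).
    exists (c * df t). exact (is_derive_scal f t c (df t) (Hf t)).
  - rewrite Rmin_left, Rmax_right; lra.
  - exists x. now apply Rmult_eq_reg_l with c.
Qed.

(** A function that expands distances by a fixed factor has a Lipschitz inverse;
    surjectivity follows from the intermediate value theorem because the
    expansion forces [f] to be unbounded in both directions. *)
Lemma expanding_inverse (f df : R -> R) (c m : R) :
  0 < m ->
  (forall x, is_derive f x (df x)) ->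
  (forall x, m <= c * df x) ->
  exists g : R -> R,
    (forall x, g (f x) = x) /\ (forall y, f (g y) = y) /\
    (forall y, continuous g y).
Proof.
  intros Hm0 Hf Hm.
  set (g := fun y => proj1_sig (expanding_surjective f df c m Hm0 Hf Hm y)).
  assert (Hfg : forall y, f (g y) = y).
  { intros y. exact (proj2_sig (expanding_surjective f df c m Hm0 Hf Hm y)). }
  assert (Hexp := expanding_abs f df c m Hf Hm).
  exists g. split; [| split]; [| exact Hfg |].
  - intros x. specialize (Hexp x (g (f x))).
    rewrite Hfg, Rminus_diag, Rabs_R0, Rmult_0_r in Hexp.
    destruct (Req_dec (g (f x)) x) as [H | H]; [exact H |].
    assert (0 < Rabs (g (f x) - x)) by (apply Rabs_pos_lt; lra). nra.
  - intros y. apply filterlim_locally. intros eps.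
    (* The [+ 1] only makes the denominator visibly positive. *)
    assert (Hd : 0 < m * eps / (Rabs c + 1)).
    { assert (H := Rabs_pos c). apply Rdiv_lt_0_compat; [| lra].
      apply Rmult_lt_0_compat; [lra | apply cond_pos]. }
    exists (mkposreal _ Hd). intros t Ht.
    change (Rabs (t - y) < m * eps / (Rabs c + 1)) in Ht.
    change (Rabs (g t - g y) < eps).
    specialize (Hexp (g y) (g t)). rewrite !Hfg in Hexp.
    assert (Hc := Rabs_pos c).
    assert (Ht' : (Rabs c + 1) * Rabs (t - y) < m * eps).
    { apply Rmult_lt_reg_r with (/ (Rabs c + 1)); [apply Rinv_0_lt_compat; lra |].
      replace ((Rabs c + 1) * Rabs (t - y) * / (Rabs c + 1)) with (Rabs (t - y))
        by (field; lra). exact Ht. }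
    assert (Hty := Rabs_pos (t - y)).
    apply Rmult_lt_reg_l with m; nra.
Qed.

Lemma derive_zero_constant (f : R -> R) :
  (forall x, is_derive f x 0) -> forall x y, f x = f y.
Proof.
  intros Hf x y. destruct (Rtotal_order x y) as [H | [-> | H]]; [| reflexivity |].
  - apply (eq_is_derive (V := R_NormedModule) f x y); [intros t _; apply Hf | exact H].
  - symmetry.
    apply (eq_is_derive (V := R_NormedModule) f y x); [intros t _; apply Hf | exact H].
Qed.

(** * The profile of the helicoid *)

(** The radicand is [1 - K sin (2 v)]; the product form keeps all later
    identities polynomial in [sin v] and [cos v]. *)
Definition rho (K v : R) : R := sqrt (1 - 2 * K * sin v * cos v).

(** The derivative of the height with respect to the angle of the ruling: the
    reciprocal of the angular speed [rho (1 + rho) / K] obtained from the first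
    integral of the minimal surface equation. *)
Definition pitch (K v : R) : R := K / (rho K v * (1 + rho K v)).

(** The base point [PI / 4] makes the ruling at height [0] the diagonal, which is
    the axis of one of the required rotations. *)
Definition height (K v : R) : R := RInt (pitch K) (PI / 4) v.

Lemma sin_sqr (v : R) : sin v * sin v = 1 - cos v * cos v.
Proof. assert (H := sin2_cos2 v). unfold Rsqr in H. lra. Qed.

Lemma radicand_bounds (K v : R) :
  -1 < K < 1 -> 0 < 1 - 2 * K * sin v * cos v <= 2.
Proof.
  intros HK. assert (H := sin_sqr v).
  set (s := sin v) in *. set (c := cos v) in *.
  assert (H1 := Rle_0_sqr (s - c)). assert (H2 := Rle_0_sqr (s + c)).
  unfold Rsqr in H1, H2.
  set (x := 2 * s * c).
  assert (Hx : -1 <= x <= 1) by (unfold x; lra).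
  replace (2 * K * s * c) with (K * x) by (unfold x; ring).
  clearbody x. destruct (Rle_dec 0 x); split; nra.
Qed.

Lemma rho_pos (K v : R) : -1 < K < 1 -> 0 < rho K v.
Proof. intros HK. apply sqrt_lt_R0, (radicand_bounds K v HK). Qed.

Lemma rho_sqr (K v : R) :
  -1 < K < 1 -> rho K v * rho K v = 1 - 2 * K * sin v * cos v.
Proof.
  intros HK. apply sqrt_sqrt. assert (H := radicand_bounds K v HK). lra.
Qed.

Lemma is_derive_rho (K v : R) :
  -1 < K < 1 ->
  is_derive (rho K) v (- K * (cos v * cos v - sin v * sin v) / rho K v).
Proof.
  intros HK. unfold rho at 1.
  assert (Hr := rho_pos K v HK).
  evar_last.
  - apply is_derive_sqrt; [| apply (radicand_bounds K v HK)].
    auto_derive; [trivial | reflexivity].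
  - cbv beta. fold (rho K v). field. lra.
Qed.

Definition dpitch (K v : R) : R :=
  (cos v * cos v - sin v * sin v) *
  (3 * pitch K v ^ 2 + 2 * (sin v * cos v) * pitch K v ^ 3).

(** This is the minimal surface equation. Writing [v'] for the derivative of the
    angle with respect to the height, [pitch = 1 / v'] has derivative
    [- v'' / v'^3], and [v'' = - cos (2 v) (3 v' + sin (2 v))]. *)
Lemma is_derive_pitch (K v : R) :
  -1 < K < 1 -> is_derive (pitch K) v (dpitch K v).
Proof.
  intros HK.
  assert (Hr := rho_pos K v HK). assert (Hr2 := rho_sqr K v HK).
  assert (Hd := is_derive_rho K v HK).
  unfold dpitch. unfold pitch at 1. evar_last.
  - auto_derive; [| reflexivity].
    repeat split; [eexists; apply Hd .. |].
    apply Rmult_integral_contrapositive; lra.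
  - replace (Derive (fun x : R => rho K x) v)
      with (- K * (cos v * cos v - sin v * sin v) / rho K v)
      by (symmetry; apply is_derive_unique, Hd).
    unfold pitch.
    set (r := rho K v) in *. set (s := sin v) in *. set (c := cos v) in *.
    clearbody r.
    (* The relation [2 K s c = 1 - r^2] turns both sides into rational functions
       of [r]. *)
    transitivity
      (K ^ 2 * (c * c - s * s) * (2 * r + 1) * (1 + r) / (r ^ 3 * (1 + r) ^ 3)).
    + field. lra.
    + replace (2 * (s * c) * (K / (r * (1 + r))) ^ 3)
        with ((1 - r * r) * K ^ 2 / (r * (1 + r)) ^ 3) by (rewrite Hr2; field; lra).
      field. lra.
Qed.

Lemma continuous_pitch (K v : R) : -1 < K < 1 -> continuous (pitch K) v.
Proof.
  intros HK. apply (ex_derive_continuous (K := R_AbsRing) (V := R_NormedModule)).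
  eexists. now apply is_derive_pitch.
Qed.

Lemma is_derive_height (K v : R) :
  -1 < K < 1 -> is_derive (height K) v (pitch K v).
Proof.
  intros HK. unfold height.
  apply (is_derive_RInt (pitch K) (RInt (pitch K) (PI / 4)) (PI / 4) v).
  - apply filter_forall. intros b. apply (RInt_correct (V := R_CompleteNormedModule)).
    apply (ex_RInt_continuous (V := R_CompleteNormedModule)).
    intros t _. now apply continuous_pitch.
  - now apply continuous_pitch.
Qed.

Lemma height_base (K : R) : height K (PI / 4) = 0.
Proof. apply (RInt_point (V := R_CompleteNormedModule)). Qed.

(** Since [rho <= sqrt 2 < 2], the denominator [rho (1 + rho)] is at most [6]. *)
Lemma pitch_bound (K v : R) : -1 < K < 1 -> K ^ 2 / 6 <= K * pitch K v.
Proof.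
  intros HK. assert (Hr := rho_pos K v HK).
  assert (Hr2 := rho_sqr K v HK). assert (Hb := radicand_bounds K v HK).
  unfold pitch. set (r := rho K v) in *.
  replace (K * (K / (r * (1 + r)))) with (K ^ 2 * / (r * (1 + r))) by (field; lra).
  apply Rmult_le_compat_l; [apply pow2_ge_0 |].
  apply Rinv_le_contravar; nra.
Qed.

Lemma pitch_neq_0 (K v : R) : -1 < K < 1 -> K <> 0 -> pitch K v <> 0.
Proof.
  intros HK HK0 H. assert (Hb := pitch_bound K v HK).
  rewrite H in Hb. assert (0 < K ^ 2) by (apply pow2_gt_0; exact HK0). lra.
Qed.

Lemma height_inverse (K : R) :
  -1 < K < 1 -> K <> 0 ->
  exists g : R -> R,
    (forall v, g (height K v) = v) /\ (forall z, height K (g z) = z) /\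
    (forall z, continuous g z).
Proof.
  intros HK HK0. apply (expanding_inverse (height K) (pitch K) K (K ^ 2 / 6)).
  - assert (0 < K ^ 2) by (apply pow2_gt_0; exact HK0). lra.
  - intros v. now apply is_derive_height.
  - intros v. now apply pitch_bound.
Qed.

(** Both symmetries of the pitch come from those of [sin (2 v)]. *)
Lemma pitch_reflect (K v : R) : pitch K (PI / 2 - v) = pitch K v.
Proof.
  unfold pitch, rho. rewrite sin_shift, cos_shift.
  now replace (2 * K * cos v * sin v) with (2 * K * sin v * cos v) by ring.
Qed.

Lemma pitch_shift (K v : R) : pitch K (v + PI) = pitch K v.
Proof.
  unfold pitch, rho. rewrite neg_sin, neg_cos.
  now replace (2 * K * - sin v * - cos v) with (2 * K * sin v * cos v) by ring.
Qed.

Lemma height_reflect (K v : R) :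
  -1 < K < 1 -> height K (PI / 2 - v) = - height K v.
Proof.
  intros HK.
  assert (H : height K (PI / 2 - v) + height K v =
              height K (PI / 2 - PI / 4) + height K (PI / 4)).
  { apply (derive_zero_constant (fun t => height K (PI / 2 - t) + height K t)).
    intros t. evar_last.
    - apply (is_derive_plus (V := R_NormedModule)).
      + apply (is_derive_comp (height K) (fun t => PI / 2 - t)).
        * now apply is_derive_height.
        * auto_derive; [trivial | reflexivity].
      + now apply is_derive_height.
    - rewrite pitch_reflect. unfold plus, scal; simpl; unfold mult; simpl. ring. }
  replace (PI / 2 - PI / 4) with (PI / 4) in H by field.
  rewrite height_base in H. lra.
Qed.

Lemma height_shift (K v : R) :
  -1 < K < 1 -> height K (v + PI) = height K v + height K (PI / 4 + PI).
Proof.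
  intros HK.
  assert (H : height K (v + PI) - height K v =
              height K (PI / 4 + PI) - height K (PI / 4)).
  { apply (derive_zero_constant (fun t => height K (t + PI) - height K t)).
    intros t. evar_last.
    - apply (is_derive_minus (V := R_NormedModule)).
      + apply (is_derive_comp (height K) (fun t => t + PI)).
        * now apply is_derive_height.
        * auto_derive; [trivial | reflexivity].
      + now apply is_derive_height.
    - rewrite pitch_shift.
      unfold minus, plus, opp, scal; simpl; unfold mult; simpl. ring. }
  rewrite height_base in H. lra.
Qed.

Lemma height_period_neq_0 (K : R) :
  -1 < K < 1 -> K <> 0 -> height K (PI / 4 + PI) <> 0.
Proof.
  intros HK HK0 H.
  destruct (height_inverse K HK HK0) as [g [Hg _]].
  assert (H1 := Hg (PI / 4 + PI)). assert (H2 := Hg (PI / 4)).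
  rewrite H in H1. rewrite height_base in H2. assert (Hpi := PI_RGT_0). lra.
Qed.

(** * Smoothness of functions built from the profile *)

(** A class of functions containing the coordinates of the helicoid, chosen to be
    closed under differentiation: once the derivative of the pitch is known as a
    polynomial in the generators, all iterated derivatives exist at once. *)
Inductive profile_algebra (K : R) : (R -> R) -> Prop :=
| pa_const a : profile_algebra K (fun _ => a)
| pa_sin : profile_algebra K sin
| pa_cos : profile_algebra K cos
| pa_pitch : profile_algebra K (pitch K)
| pa_height : profile_algebra K (height K)
| pa_exp a : profile_algebra K (fun v => exp (a * height K v))
| pa_plus f g : profile_algebra K f -> profile_algebra K g ->
    profile_algebra K (fun v => f v + g v)
| pa_mult f g : profile_algebra K f -> profile_algebra K g ->
    profile_algebra K (fun v => f v * g v).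

Lemma pa_ext (K : R) (f g : R -> R) :
  profile_algebra K f -> (forall v, f v = g v) -> profile_algebra K g.
Proof. intros Hf H. now rewrite <- (functional_extensionality _ _ H). Qed.

Lemma pa_derive (K : R) (f : R -> R) :
  -1 < K < 1 -> profile_algebra K f ->
  exists f', profile_algebra K f' /\ forall v, is_derive f v (f' v).
Proof.
  intros HK. induction 1 as
    [a | | | | | a | f g Hf [f' [Af' Df]] Hg [g' [Ag' Dg]]
                   | f g Hf [f' [Af' Df]] Hg [g' [Ag' Dg]]].
  - exists (fun _ => 0). split; [constructor |].
    intros v. apply (is_derive_const (V := R_NormedModule)).
  - exists cos. split; [constructor | exact is_derive_sin].
  - exists (fun v => -1 * sin v). split; [repeat constructor |].
    intros v. replace (-1 * sin v) with (- sin v) by ring. apply is_derive_cos.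
  - eexists. split; [| intros v; now apply is_derive_pitch].
    apply pa_ext with (fun v =>
      (cos v * cos v + -1 * (sin v * sin v)) *
      (3 * (pitch K v * pitch K v) +
       2 * (sin v * cos v) * (pitch K v * (pitch K v * pitch K v)))).
    + repeat constructor.
    + intros v; unfold dpitch; ring.
  - exists (pitch K). split; [constructor | intros v; now apply is_derive_height].
  - exists (fun v => a * pitch K v * exp (a * height K v)).
    split; [repeat constructor |]. intros v.
    apply (is_derive_comp exp (fun t => a * height K t)); [apply is_derive_exp |].
    exact (is_derive_scal _ _ _ _ (is_derive_height K v HK)).
  - exists (fun v => f' v + g' v). split; [now constructor |].
    intros v. now apply (is_derive_plus (V := R_NormedModule)).
  - exists (fun v => f' v * g v + f v * g' v). split; [now repeat constructor |].
    intros v. apply (is_derive_mult f g v); [apply Df | apply Dg | intros; apply Rmult_comm].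
Qed.

Lemma pa_continuous (K : R) (f : R -> R) (v : R) :
  -1 < K < 1 -> profile_algebra K f -> continuous f v.
Proof.
  intros HK Hf. destruct (pa_derive K f HK Hf) as [f' [_ Df]].
  apply (ex_derive_continuous (K := R_AbsRing) (V := R_NormedModule)).
  exists (f' v). apply Df.
Qed.

(** Functions affine along the rulings are stable under both partial derivatives:
    differentiating along a ruling keeps only the slope, differentiating across
    acts on the coefficients. *)
Lemma ruled_Ck (K : R) (n : nat) (f g : R -> R) :
  -1 < K < 1 -> profile_algebra K f -> profile_algebra K g ->
  Ck_on n (fun _ => True) (fun q => fst q * f (snd q) + g (snd q)).
Proof.
  intros HK. revert f g. induction n as [| n IH]; intros f g Hf Hg.
  - intros [u v] _.
    apply (continuous_plus (V := R_NormedModule)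
             (fun q : R * R => fst q * f (snd q)) (fun q => g (snd q))).
    + apply (continuous_mult (K := R_AbsRing) fst (fun q : R * R => f (snd q))).
      * apply continuous_fst.
      * apply (continuous_comp snd f); [apply continuous_snd |].
        now apply pa_continuous with K.
    + apply (continuous_comp snd g); [apply continuous_snd |].
      now apply pa_continuous with K.
  - destruct (pa_derive K f HK Hf) as [f' [Af' Df]].
    destruct (pa_derive K g HK Hg) as [g' [Ag' Dg]].
    assert (Hu : forall u v, is_derive (fun t => t * f v + g v) u (f v)).
    { intros u v. auto_derive; [trivial | ring]. }
    assert (Hv : forall u v,
              is_derive (fun t => u * f t + g t) v (u * f' v + g' v)).
    { intros u v. apply (is_derive_plus (V := R_NormedModule)); [| apply Dg].
      exact (is_derive_scal f v u _ (Df v)). }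
    split; [| split; [| split]].
    + intros [u v] _. exists (f v). exact (Hu u v).
    + intros [u v] _. exists (u * f' v + g' v). exact (Hv u v).
    + replace (Du _) with (fun q : R * R => fst q * 0 + f (snd q)).
      * exact (IH (fun _ => 0) f (pa_const K 0) Hf).
      * apply functional_extensionality. intros [u v]. unfold Du. simpl.
        rewrite Rmult_0_r, Rplus_0_l. symmetry. apply is_derive_unique, Hu.
    + replace (Dv _) with (fun q : R * R => fst q * f' (snd q) + g' (snd q)).
      * exact (IH f' g' Af' Ag').
      * apply functional_extensionality. intros [u v]. unfold Dv. simpl.
        symmetry. apply is_derive_unique, Hv.
Qed.

(** * The helicoid as a parametrized surface *)

(** Polar-like coordinates: [u] runs along a ruling and [v] is the angle of that
    ruling in the left-invariant frame. *)
Definition patch (K : R) (q : R * R) : point :=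
  (fst q * (exp (- height K (snd q)) * cos (snd q)),
   fst q * (exp (height K (snd q)) * sin (snd q)),
   height K (snd q)).

Lemma patch_smooth (K : R) :
  -1 < K < 1 -> smooth_on (fun _ => True) (patch K).
Proof.
  intros HK n i.
  set (f := fun v => match i with
                     | ax1 => exp (-1 * height K v) * cos v
                     | ax2 => exp (1 * height K v) * sin v
                     | ax3 => 0
                     end).
  set (g := fun v => match i with ax3 => height K v | _ => 0 end).
  replace (fun q => coord i (patch K q))
    with (fun q : R * R => fst q * f (snd q) + g (snd q)).
  - apply ruled_Ck with K; [exact HK | |]; unfold f, g; destruct i;
      repeat constructor.
  - apply functional_extensionality. intros [u v]. unfold f, g.
    destruct i; simpl.
    + replace (-1 * height K v) with (- height K v) by ring. ring.
    + rewrite Rmult_1_l. ring.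
    + ring.
Qed.

Definition patch_u (K : R) (q : R * R) : point :=
  (exp (- height K (snd q)) * cos (snd q),
   exp (height K (snd q)) * sin (snd q),
   0).

Definition patch_v (K : R) (q : R * R) : point :=
  let v := snd q in
  (fst q * (exp (- height K v) * (- sin v - pitch K v * cos v)),
   fst q * (exp (height K v) * (cos v + pitch K v * sin v)),
   pitch K v).

Definition patch_uv (K : R) (q : R * R) : point :=
  let v := snd q in
  (exp (- height K v) * (- sin v - pitch K v * cos v),
   exp (height K v) * (cos v + pitch K v * sin v),
   0).

Definition patch_vv (K : R) (q : R * R) : point :=
  let v := snd q in
  (fst q * (exp (- height K v) *
     (- cos v + 2 * pitch K v * sin v
      + (pitch K v ^ 2 - dpitch K v) * cos v)),
   fst q * (exp (height K v) *
     (- sin v + 2 * pitch K v * cos v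
      + (pitch K v ^ 2 + dpitch K v) * sin v)),
   dpitch K v).

Ltac derive_profile K v HK :=
  let Hh := fresh in let Hp := fresh in
  assert (Hh := is_derive_height K v HK);
  assert (Hp := is_derive_pitch K v HK);
  apply is_derive_unique;
  auto_derive;
  [ repeat split;
    lazymatch goal with
    | |- context [height] => exact (ex_intro _ _ Hh)
    | |- context [pitch] => exact (ex_intro _ _ Hp)
    end
  | try replace (Derive (fun x : R => height K x) v) with (pitch K v)
      by (symmetry; apply is_derive_unique, Hh);
    try replace (Derive (fun x : R => pitch K x) v) with (dpitch K v)
      by (symmetry; apply is_derive_unique, Hp);
    ring ].

Lemma Du_patch (K : R) (i : axis) :
  Du (fun q => coord i (patch K q)) = (fun q => coord i (patch_u K q)).
Proof.
  apply functional_extensionality. intros [u v]. unfold Du.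
  destruct i; simpl; apply is_derive_unique; auto_derive; trivial; ring.
Qed.

Lemma Dv_patch (K : R) (i : axis) :
  -1 < K < 1 ->
  Dv (fun q => coord i (patch K q)) = (fun q => coord i (patch_v K q)).
Proof.
  intros HK. apply functional_extensionality. intros [u v]. unfold Dv.
  destruct i; simpl; derive_profile K v HK.
Qed.

Lemma Du_patch_u (K : R) (i : axis) :
  Du (fun q => coord i (patch_u K q)) = (fun _ => 0).
Proof.
  apply functional_extensionality. intros [u v]. unfold Du.
  destruct i; simpl; apply Derive_const.
Qed.

Lemma Du_patch_v (K : R) (i : axis) :
  Du (fun q => coord i (patch_v K q)) = (fun q => coord i (patch_uv K q)).
Proof.
  apply functional_extensionality. intros [u v]. unfold Du.
  destruct i; simpl; apply is_derive_unique; auto_derive; trivial; ring.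
Qed.

Lemma Dv_patch_v (K : R) (i : axis) :
  -1 < K < 1 ->
  Dv (fun q => coord i (patch_v K q)) = (fun q => coord i (patch_vv K q)).
Proof.
  intros HK. apply functional_extensionality. intros [u v]. unfold Dv.
  destruct i; simpl; derive_profile K v HK.
Qed.

(** * Minimality *)

Lemma tangent_Du_patch (K : R) (q : R * R) :
  tangent Du (patch K) q = (fun i => coord i (patch_u K q)).
Proof.
  apply functional_extensionality. intros i. unfold tangent. now rewrite Du_patch.
Qed.

Lemma tangent_Dv_patch (K : R) (q : R * R) :
  -1 < K < 1 -> tangent Dv (patch K) q = (fun i => coord i (patch_v K q)).
Proof.
  intros HK. apply functional_extensionality. intros i. unfold tangent.
  now rewrite Dv_patch.
Qed.

Lemma christoffel_sol (i j l : axis) (p : point) :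
  christoffel i j l p =
  match i, j, l with
  | ax1, ax1, ax3 => - exp (2 * coord ax3 p)
  | ax1, ax3, ax1 | ax3, ax1, ax1 => exp (2 * coord ax3 p)
  | ax2, ax2, ax3 => exp (- (2 * coord ax3 p))
  | ax2, ax3, ax2 | ax3, ax2, ax2 => - exp (- (2 * coord ax3 p))
  | _, _, _ => 0
  end.
Proof.
  destruct p as [[x1 x2] x3].
  assert (H1 : Derive (fun t => exp (2 * t)) x3 = 2 * exp (2 * x3)).
  { apply is_derive_unique. auto_derive; [trivial | ring]. }
  assert (H2 : Derive (fun t => exp (- (2 * t))) x3 = - (2 * exp (- (2 * x3)))).
  { apply is_derive_unique. auto_derive; [trivial | ring]. }
  unfold christoffel, partial.
  destruct i, j, l; simpl; rewrite ?Derive_const, ?H1, ?H2; field.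
Qed.

(** The Euclidean cross product of [patch_u] and [patch_v] is a conormal; raising
    its index with the metric multiplies the first two components by [e^(-2 z)]
    and [e^(2 z)]. *)
Definition normal_direction (K : R) (q : R * R) : axis -> R :=
  let u := fst q in let v := snd q in
  fun i => match i with
  | ax1 => exp (- height K v) * (pitch K v * sin v)
  | ax2 => - (exp (height K v) * (pitch K v * cos v))
  | ax3 => u * (1 + 2 * pitch K v * (sin v * cos v))
  end.

Lemma exp_mul_opp (x : R) : exp x * exp (- x) = 1.
Proof. now rewrite <- exp_plus, Rplus_opp_r, exp_0. Qed.

Lemma exp_double (x : R) : exp (2 * x) = exp x * exp x.
Proof. rewrite <- exp_plus. f_equal. ring. Qed.

Lemma exp_opp_double (x : R) : exp (- (2 * x)) = exp (- x) * exp (- x).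
Proof. rewrite <- exp_plus. f_equal. ring. Qed.

(* Every quantity below is a polynomial in [e^z], [e^(-z)], [sin v], [cos v] and
   the pitch, so identities hold modulo [e^z e^(-z) = 1] and
   [sin^2 + cos^2 = 1]. *)
Ltac sol_algebra K v :=
  cbv zeta;
  unfold patch, patch_u, patch_v, patch_uv, patch_vv, normal_direction;
  cbn [coord fst snd];
  rewrite ?exp_double, ?exp_opp_double;
  ring [(exp_mul_opp (height K v)) (sin_sqr v)].

Lemma inner_sol (p : point) (v w : axis -> R) :
  inner p v w =
  exp (2 * coord ax3 p) * v ax1 * w ax1
  + exp (- (2 * coord ax3 p)) * v ax2 * w ax2 + v ax3 * w ax3.
Proof. unfold inner, sum3, sol_metric. ring. Qed.

Lemma second_form_sol (D D' : (R * R -> R) -> R * R -> R) X q n :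
  second_form D D' X q n =
  inner (X q) (fun k => D (D' (fun r => coord k (X r))) q) n +
  (exp (2 * coord ax3 (X q)) *
     (n ax1 * (tangent D X q ax1 * tangent D' X q ax3
               + tangent D X q ax3 * tangent D' X q ax1)
      - n ax3 * (tangent D X q ax1 * tangent D' X q ax1))
   - exp (- (2 * coord ax3 (X q))) *
     (n ax2 * (tangent D X q ax2 * tangent D' X q ax3
               + tangent D X q ax3 * tangent D' X q ax2)
      - n ax3 * (tangent D X q ax2 * tangent D' X q ax2))).
Proof. unfold second_form, sum3. rewrite !christoffel_sol. ring. Qed.

Lemma second_form_scale (D D' : (R * R -> R) -> R * R -> R) X q k n :
  second_form D D' X q (fun i => k * n i) = k * second_form D D' X q n.
Proof. rewrite !second_form_sol, !inner_sol. ring. Qed.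

Lemma patch_first_form (K u v : R) :
  -1 < K < 1 ->
  let s := sin v in let c := cos v in let g := pitch K v in
  first_form Du Du (patch K) (u, v) = 1 /\
  first_form Du Dv (patch K) (u, v) = - (u * g * (c * c - s * s)) /\
  first_form Dv Dv (patch K) (u, v) = u ^ 2 * (1 + g ^ 2 + 4 * g * (s * c)) + g ^ 2.
Proof.
  intros HK. unfold first_form.
  rewrite tangent_Du_patch, tangent_Dv_patch, !inner_sol by exact HK.
  repeat split; sol_algebra K v.
Qed.

Lemma patch_second_form (K u v : R) :
  -1 < K < 1 ->
  let s := sin v in let c := cos v in let g := pitch K v in
  let n := normal_direction K (u, v) in
  second_form Du Du (patch K) (u, v) n =
    - (u * (1 + 2 * g * (s * c)) * (c * c - s * s)) /\
  second_form Du Dv (patch K) (u, v) n =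
    u ^ 2 * (1 + 2 * g * (s * c)) * (g + 2 * (s * c)) - g /\
  second_form Dv Dv (patch K) (u, v) n =
    u * dpitch K v
    - u ^ 3 * (1 + 2 * g * (s * c)) * (c * c - s * s) * (g ^ 2 - 1).
Proof.
  intros HK. cbv zeta. rewrite !second_form_sol, !inner_sol.
  rewrite tangent_Du_patch, tangent_Dv_patch by exact HK.
  rewrite !Du_patch, !Dv_patch, !Du_patch_u, !Du_patch_v, !Dv_patch_v by exact HK.
  repeat split; sol_algebra K v.
Qed.

Lemma normal_direction_orthogonal (K u v : R) :
  -1 < K < 1 ->
  inner (patch K (u, v)) (normal_direction K (u, v))
    (tangent Du (patch K) (u, v)) = 0 /\
  inner (patch K (u, v)) (normal_direction K (u, v))
    (tangent Dv (patch K) (u, v)) = 0.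
Proof.
  intros HK. rewrite tangent_Du_patch, tangent_Dv_patch, !inner_sol by exact HK.
  split; sol_algebra K v.
Qed.

Lemma normal_direction_norm (K u v : R) :
  inner (patch K (u, v)) (normal_direction K (u, v)) (normal_direction K (u, v)) =
  pitch K v ^ 2 + (u * (1 + 2 * pitch K v * (sin v * cos v))) ^ 2.
Proof. rewrite inner_sol. sol_algebra K v. Qed.

Lemma inner_scale (p : point) (a b : R) (v w : axis -> R) :
  inner p (fun i => a * v i) (fun i => b * w i) = a * b * inner p v w.
Proof. rewrite !inner_sol. ring. Qed.

Lemma inner_scale_l (p : point) (a : R) (v w : axis -> R) :
  inner p (fun i => a * v i) w = a * inner p v w.
Proof. rewrite !inner_sol. ring. Qed.

(** In the numerator of the mean curvature the terms of degree three in [u] cancel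
    for any pitch, and the vanishing of the terms of degree one is exactly
    the formula for [dpitch]. *)
Lemma patch_minimal (K : R) (q : R * R) :
  -1 < K < 1 -> K <> 0 ->
  exists n, unit_normal (patch K) q n /\ mean_curvature (patch K) q n = 0.
Proof.
  intros HK HK0. destruct q as [u v].
  set (N := inner (patch K (u, v)) (normal_direction K (u, v))
              (normal_direction K (u, v))).
  assert (HN : 0 < N).
  { unfold N. rewrite normal_direction_norm.
    assert (H1 := pow2_gt_0 _ (pitch_neq_0 K v HK HK0)).
    assert (H2 := pow2_ge_0 (u * (1 + 2 * pitch K v * (sin v * cos v)))). lra. }
  (* The numerator of the mean curvature is linear in the normal, so normalizing
     does not affect its vanishing. *)
  exists (fun i => / sqrt N * normal_direction K (u, v) i). split.
  - destruct (normal_direction_orthogonal K u v HK) as [H1 H2].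
    split; [| split].
    + rewrite inner_scale_l, H1. ring.
    + rewrite inner_scale_l, H2. ring.
    + rewrite inner_scale. fold N.
      rewrite <- (sqrt_sqrt N) at 3 by lra.
      assert (H := sqrt_lt_R0 N HN). field. lra.
  - unfold mean_curvature. rewrite !second_form_scale.
    destruct (patch_first_form K u v HK) as (-> & -> & ->).
    destruct (patch_second_form K u v HK) as (-> & -> & ->).
    unfold Rdiv. apply Rmult_eq_0_compat_r. unfold dpitch. ring.
Qed.

(** * The helicoid as a subset of the ambient space *)

Lemma point_eq (x1 x2 x3 y1 y2 y3 : R) :
  x1 = y1 -> x2 = y2 -> x3 = y3 -> (x1, x2, x3) = (y1, y2, y3) :> point.
Proof. now intros -> -> ->. Qed.

Definition helicoid_surface (K : R) (p : point) : Prop :=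
  exists q, patch K q = p.

Lemma patch_immersed (K : R) (q : R * R) :
  -1 < K < 1 -> K <> 0 -> immersed_at (patch K) q.
Proof.
  intros HK HK0 a b H. rewrite tangent_Du_patch, tangent_Dv_patch in H by exact HK.
  destruct q as [u v].
  assert (H1 := H ax1). assert (H2 := H ax2). assert (H3 := H ax3).
  unfold patch_u, patch_v in *. cbn [coord fst snd] in *.
  assert (Hg := pitch_neq_0 K v HK HK0).
  assert (Hb : b = 0).
  { apply Rmult_eq_reg_r with (pitch K v); [lra | exact Hg]. }
  split; [| exact Hb]. subst b.
  assert (HE := exp_mul_opp (height K v)). assert (HS := sin_sqr v).
  set (E := exp (height K v)) in *. set (M := exp (- height K v)) in *.
  assert (Hc : a * cos v = 0).
  { transitivity (E * (a * (M * cos v) + 0)); [ring [HE] |].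
    rewrite Rmult_0_l in H1. rewrite H1. ring. }
  assert (Hs : a * sin v = 0).
  { transitivity (M * (a * (E * sin v) + 0)); [ring [HE] |].
    rewrite Rmult_0_l in H2. rewrite H2. ring. }
  transitivity (a * cos v * cos v + a * sin v * sin v); [ring [HS] |].
  rewrite Hc, Hs. ring.
Qed.

Lemma continuous_x3 (f : R -> R) (p : point) :
  (forall z, continuous f z) -> continuous (fun x : point => f (snd x)) p.
Proof.
  intros Hf. destruct p as [x z].
  apply (continuous_comp snd f); [apply continuous_snd | apply Hf].
Qed.

Lemma continuous_twisted_combination (a b : R -> R) (p : point) :
  (forall z, continuous a z) -> (forall z, continuous b z) ->
  continuous (fun x : point =>
    fst (fst x) * a (snd x) + snd (fst x) * b (snd x)) p.
Proof.
  intros Ha Hb.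
  apply (continuous_plus (V := R_NormedModule)
           (fun x : point => fst (fst x) * a (snd x))
           (fun x : point => snd (fst x) * b (snd x))).
  - apply (continuous_mult (K := R_AbsRing)
             (fun x : point => fst (fst x)) (fun x : point => a (snd x))).
    + destruct p as [[x1 x2] x3].
      apply (continuous_comp fst fst); apply continuous_fst.
    + now apply continuous_x3.
  - apply (continuous_mult (K := R_AbsRing)
             (fun x : point => snd (fst x)) (fun x : point => b (snd x))).
    + destruct p as [[x1 x2] x3].
      apply (continuous_comp fst snd); [apply continuous_fst | apply continuous_snd].
    + now apply continuous_x3.
Qed.

Lemma continuous_mult_R (f g : R -> R) (z : R) :
  continuous f z -> continuous g z -> continuous (fun t => f t * g t) z.
Proof. exact (continuous_mult (K := R_AbsRing) f g z). Qed.

Lemma continuous_exp_opp (z : R) : continuous (fun t => exp (- t)) z.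
Proof.
  apply (ex_derive_continuous (K := R_AbsRing) (V := R_NormedModule)).
  auto_derive; trivial.
Qed.

Lemma continuous_cos_comp (g : R -> R) (z : R) :
  continuous g z -> continuous (fun t => cos (g t)) z.
Proof.
  intros Hg. apply (continuous_comp g cos); [exact Hg |]. apply continuous_cos.
Qed.

Lemma continuous_sin_comp (g : R -> R) (z : R) :
  continuous g z -> continuous (fun t => sin (g t)) z.
Proof.
  intros Hg. apply (continuous_comp g sin); [exact Hg |]. apply continuous_sin.
Qed.

(** The inverse of [patch] is continuous on the whole space: the angle is read off
    from the height, and the position on the ruling is the component of
    [(x1, x2)] along it in the orthonormal frame. *)
Lemma patch_chart (K : R) :
  -1 < K < 1 -> K <> 0 ->
  chart (helicoid_surface K) (fun _ => True) (patch K).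
Proof.
  intros HK HK0. split; [apply open_true |].
  split; [now apply patch_smooth |].
  split; [intros q _; now apply patch_immersed |].
  destruct (height_inverse K HK HK0) as (g & Hgh & Hhg & Hg).
  exists (fun _ => True).
  exists (fun p : point =>
    (fst (fst p) * (exp (snd p) * cos (g (snd p)))
     + snd (fst p) * (exp (- snd p) * sin (g (snd p))), g (snd p))).
  split; [apply open_true |]. split; [| split].
  - intros p. unfold helicoid_surface. split.
    + intros [[q Hq] _]. now exists q.
    + intros [q [_ Hq]]. split; [now exists q | trivial].
  - intros [u v] _. unfold patch. cbn [fst snd]. rewrite Hgh.
    f_equal. assert (HE := exp_mul_opp (height K v)). ring [HE (sin_sqr v)].
  - intros p _ _.
    refine (filterlim_filter_le_1 _ (filter_le_within (F := locally p) _) _).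
    refine (continuous_comp_2
      (fun p : point => fst (fst p) * (exp (snd p) * cos (g (snd p)))
                        + snd (fst p) * (exp (- snd p) * sin (g (snd p))))
      (fun p : point => g (snd p)) (fun a b : R => (a, b)) p _ _ _).
    + apply (continuous_twisted_combination
               (fun z => exp z * cos (g z)) (fun z => exp (- z) * sin (g z)));
        intros z; apply continuous_mult_R.
      * apply continuous_exp.
      * now apply continuous_cos_comp.
      * apply continuous_exp_opp.
      * now apply continuous_sin_comp.
    + now apply continuous_x3.
    + apply (continuous_ext (fun x => x)); [now intros [a b] | apply continuous_id].
Qed.

Lemma helicoid_embedded (K : R) :
  -1 < K < 1 -> K <> 0 -> embedded_surface (helicoid_surface K).
Proof.
  intros HK HK0 p [q Hq]. exists (fun _ => True), (patch K), q.
  split; [now apply patch_chart | now split].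
Qed.

Lemma helicoid_minimal (K : R) :
  -1 < K < 1 -> K <> 0 -> minimal_surface (helicoid_surface K).
Proof.
  intros HK HK0. split; [now apply helicoid_embedded |].
  intros p [q Hq]. destruct (patch_minimal K q HK HK0) as [n [Hn Hm]].
  exists (fun _ => True), (patch K), q, n.
  split; [now apply patch_chart |].
  split; [trivial |]. split; [exact Hq |]. now split.
Qed.

(** A point lies on the surface when its component orthogonal to the ruling at its
    own height vanishes, which is a continuous condition. *)
Lemma helicoid_closed (K : R) :
  -1 < K < 1 -> K <> 0 -> closed (helicoid_surface K).
Proof.
  intros HK HK0. destruct (height_inverse K HK HK0) as (g & Hgh & Hhg & Hg).
  apply closed_ext with (fun p : point =>
    fst (fst p) * (exp (snd p) * sin (g (snd p)))
    + snd (fst p) * (exp (- snd p) * - cos (g (snd p))) = 0).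
  - intros [[x1 x2] x3]. cbn [fst snd]. assert (HE := exp_mul_opp x3). split.
    + assert (Hv := Hhg x3). set (v := g x3) in *. intros H.
      exists (x1 * (exp x3 * cos v) + x2 * (exp (- x3) * sin v), v).
      unfold patch. cbn [fst snd]. rewrite Hv.
      assert (HS := sin_sqr v).
      apply point_eq; [| | reflexivity].
      * transitivity (x1 - exp (- x3) * sin v *
          (x1 * (exp x3 * sin v) + x2 * (exp (- x3) * - cos v))).
        { ring [HE HS]. }
        rewrite H. ring.
      * transitivity (x2 + exp x3 * cos v *
          (x1 * (exp x3 * sin v) + x2 * (exp (- x3) * - cos v))).
        { ring [HE HS]. }
        rewrite H. ring.
    + intros [[u v] H]. unfold patch in H. cbn [fst snd] in H.
      injection H as <- <- <-. rewrite Hgh. ring [(exp_mul_opp (height K v))].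
  - apply (closed_comp (fun p : point =>
      fst (fst p) * (exp (snd p) * sin (g (snd p)))
      + snd (fst p) * (exp (- snd p) * - cos (g (snd p)))) (fun t => t = 0)).
    + intros p. apply (continuous_twisted_combination
        (fun z => exp z * sin (g z)) (fun z => exp (- z) * - cos (g z)));
        intros z; apply continuous_mult_R.
      * apply continuous_exp.
      * now apply continuous_sin_comp.
      * apply continuous_exp_opp.
      * apply (continuous_opp (V := R_NormedModule) (fun t => cos (g t))).
        now apply continuous_cos_comp.
    + apply closed_eq.
Qed.

Lemma closed_inter_compact {T : UniformSpace} (S C : T -> Prop) :
  closed S -> compact_set C -> compact_set (fun x => S x /\ C x).
Proof.
  intros HS HC I D HD Hcov.
  destruct (HC (option I) (fun o x => match o with
                                      | Some i => D i x
                                      | None => ~ S x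
                                      end)) as [l Hl].
  - intros [i |]; [apply HD | now apply open_not].
  - intros x Hx. destruct (classic (S x)) as [H | H].
    + destruct (Hcov x (conj H Hx)) as [i Hi]. now exists (Some i).
    + now exists None.
  - exists (flat_map (fun o => match o with Some i => i :: nil | None => nil end) l).
    intros x [Hx HCx]. destruct (Hl x HCx) as [[i |] [Hin Hi]].
    + exists i. split; [| exact Hi]. apply in_flat_map.
      exists (Some i). split; [exact Hin | now left].
    + contradiction.
Qed.

Lemma helicoid_properly_embedded (K : R) :
  -1 < K < 1 -> K <> 0 -> properly_embedded_surface (helicoid_surface K).
Proof.
  intros HK HK0. split; [now apply helicoid_embedded |].
  intros C HC. apply closed_inter_compact; [now apply helicoid_closed | exact HC].
Qed.

(** * Axis, rulings and symmetries *)

Lemma helicoid_axis (K : R) :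
  -1 < K < 1 -> K <> 0 -> contains_x3_axis (helicoid_surface K).
Proof.
  intros HK HK0 t. destruct (height_inverse K HK HK0) as (g & _ & Hhg & _).
  exists (0, g t). unfold patch. cbn [fst snd]. rewrite Hhg, !Rmult_0_l. reflexivity.
Qed.

Lemma helicoid_slices (K : R) :
  -1 < K < 1 -> K <> 0 -> horizontal_slices_are_lines (helicoid_surface K).
Proof.
  intros HK HK0 t. destruct (height_inverse K HK HK0) as (g & Hgh & Hhg & _).
  exists (0, 0, t), (exp (- t) * cos (g t), exp t * sin (g t), 0). split.
  - intros H. injection H as H1 H2.
    apply (cos_sin_0 (g t)).
    assert (E1 := exp_pos t). assert (E2 := exp_pos (- t)).
    apply Rmult_integral in H1. apply Rmult_integral in H2.
    split; [destruct H1 | destruct H2]; lra.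
  - intros [[x1 x2] x3]. split.
    + intros [[[u v] H] Ht]. cbn [coord] in Ht.
      unfold patch in H. cbn [fst snd] in H. injection H as <- <- H3.
      rewrite Ht in H3. exists u. rewrite <- H3, Hgh.
      intros []; cbn [coord]; rewrite ?H3; lra.
    + intros [s H].
      assert (H1 := H ax1). assert (H2 := H ax2). assert (H3 := H ax3).
      cbn [coord] in *. split; [| lra].
      exists (s, g t). unfold patch. cbn [fst snd]. rewrite Hhg.
      apply point_eq; lra.
Qed.

(** Surjectivity of the reparametrization [a] is what makes the image of the
    surface all of it. *)
Lemma helicoid_invariant (K : R) (f : point -> point) (a b : R * R -> R * R) :
  (forall q, f (patch K q) = patch K (a q)) -> (forall q, a (b q) = q) ->
  invariant_under f (helicoid_surface K).
Proof.
  intros Hf Hab p. split.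
  - intros [q Hq]. exists (patch K (b q)). split; [now exists (b q) |].
    now rewrite Hf, Hab.
  - intros [p0 [[q <-] <-]]. exists (a q). now rewrite Hf.
Qed.

Lemma helicoid_translation (K : R) :
  -1 < K < 1 ->
  invariant_under (sol_mul (0, 0, height K (PI / 4 + PI))) (helicoid_surface K).
Proof.
  intros HK.
  apply (helicoid_invariant K _
    (fun q => (- fst q, snd q + PI)) (fun q => (- fst q, snd q - PI))).
  - intros [u v]. unfold patch, sol_mul. cbn [fst snd].
    rewrite (height_shift K v HK), neg_cos, neg_sin, Ropp_plus_distr, !exp_plus.
    apply point_eq; ring.
  - intros [u v]. cbn [fst snd]. f_equal; ring.
Qed.

Lemma helicoid_rotation_x3_axis (K : R) :
  invariant_under rotation_x3_axis (helicoid_surface K).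
Proof.
  apply (helicoid_invariant K _
    (fun q => (- fst q, snd q)) (fun q => (- fst q, snd q))).
  - intros [u v]. unfold patch, rotation_x3_axis. cbn [fst snd].
    apply point_eq; ring.
  - intros [u v]. cbn [fst snd]. f_equal; ring.
Qed.

Lemma helicoid_rotation_diagonal (K : R) :
  -1 < K < 1 -> invariant_under rotation_diagonal (helicoid_surface K).
Proof.
  intros HK. apply (helicoid_invariant K _
    (fun q => (fst q, PI / 2 - snd q)) (fun q => (fst q, PI / 2 - snd q))).
  - intros [u v]. unfold patch, rotation_diagonal. cbn [fst snd].
    rewrite height_reflect, cos_shift, sin_shift, Ropp_involutive by exact HK.
    reflexivity.
  - intros [u v]. cbn [fst snd]. f_equal; ring.
Qed.

Lemma helicoid_rotation_antidiagonal (K : R) :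
  -1 < K < 1 -> invariant_under rotation_antidiagonal (helicoid_surface K).
Proof.
  intros HK. apply (helicoid_invariant K _
    (fun q => (- fst q, PI / 2 - snd q)) (fun q => (- fst q, PI / 2 - snd q))).
  - intros [u v]. unfold patch, rotation_antidiagonal. cbn [fst snd].
    rewrite height_reflect, cos_shift, sin_shift, Ropp_involutive by exact HK.
    apply point_eq; ring.
  - intros [u v]. cbn [fst snd]. f_equal; ring.
Qed.

(** * Distinct parameters give distinct surfaces *)

Lemma sin_eq_0_small (x : R) : Rabs x < 1 -> sin x = 0 -> x = 0.
Proof.
  intros Hx Hs. apply Rabs_def2 in Hx.
  assert (Hpi := PI2_1). assert (Hpi' := PI_RGT_0).
  destruct (Rtotal_order x 0) as [H | [H | H]]; [| exact H |].
  - assert (H1 := sin_gt_0 (- x) ltac:(lra) ltac:(lra)).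
    rewrite sin_neg in H1. lra.
  - assert (H1 := sin_gt_0 x ltac:(lra) ltac:(lra)). lra.
Qed.

(** The point of parameters [(1, v)] has some angle [w] in the other
    parametrization. Both angles describe the same line, so [w - v] is a multiple
    of [PI]; since the height expands distances, closeness of the two heights
    forces [|w - v| < 1], which leaves only [w = v]. *)
Lemma same_surface_same_height (K K' v : R) :
  -1 < K < 1 -> -1 < K' < 1 -> K' <> 0 ->
  (forall p, helicoid_surface K p -> helicoid_surface K' p) ->
  Rabs K' * Rabs (height K v - height K' v) < K' ^ 2 / 6 ->
  height K v = height K' v.
Proof.
  intros HK HK' HK0 Hsub Hnear.
  destruct (Hsub (patch K (1, v)) (ex_intro _ _ eq_refl)) as [[u w] H].
  unfold patch in H. cbn [fst snd] in H. injection H as H1 H2 H3.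
  rewrite H3 in H1, H2. rewrite !Rmult_1_l in *.
  assert (Hsq : 0 < K' ^ 2) by (apply pow2_gt_0; exact HK0).
  assert (Hwv : Rabs (w - v) < 1).
  { assert (He := expanding_abs (height K') (pitch K') K' (K' ^ 2 / 6)
      (fun x => is_derive_height K' x HK') (fun x => pitch_bound K' x HK') v w).
    rewrite H3 in He. nra. }
  assert (Hs : sin (w - v) = 0).
  { assert (Hc : u * cos w = cos v).
    { apply Rmult_eq_reg_l with (exp (- height K v)); [lra |].
      apply Rgt_not_eq, exp_pos. }
    assert (Hs : u * sin w = sin v).
    { apply Rmult_eq_reg_l with (exp (height K v)); [lra |].
      apply Rgt_not_eq, exp_pos. }
    rewrite sin_minus, <- Hs, <- Hc. ring. }
  apply sin_eq_0_small in Hs; [| exact Hwv].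
  rewrite <- H3. f_equal. lra.
Qed.

(** As [rho = sqrt (1 - K)] at [PI / 4], this value is injective in [K]. *)
Lemma pitch_base (K : R) : -1 < K < 1 -> pitch K (PI / 4) = / sqrt (1 - K) - 1.
Proof.
  intros HK. unfold pitch, rho.
  replace (2 * K * sin (PI / 4) * cos (PI / 4)) with K.
  - assert (Hp := sqrt_lt_R0 (1 - K) ltac:(lra)).
    assert (H := sqrt_sqrt (1 - K) ltac:(lra)).
    set (r := sqrt (1 - K)) in *.
    replace K with (1 - r * r) by lra. field. lra.
  - transitivity (K * (2 * sin (PI / 4) * cos (PI / 4))); [| ring].
    rewrite <- sin_2a. replace (2 * (PI / 4)) with (PI / 2) by field.
    rewrite sin_PI2. ring.
Qed.

Lemma helicoid_surface_injective (K K' : R) :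
  -1 < K < 1 -> -1 < K' < 1 -> K' <> 0 ->
  (forall p, helicoid_surface K p -> helicoid_surface K' p) -> K = K'.
Proof.
  intros HK HK' HK0 Hsub.
  assert (Hd := is_derive_height K (PI / 4) HK).
  assert (Hd' := is_derive_height K' (PI / 4) HK').
  assert (Hsq : 0 < K' ^ 2) by (apply pow2_gt_0; exact HK0).
  assert (Hloc : locally (PI / 4) (fun v => height K v = height K' v)).
  { assert (Hc : continuous (fun v => height K v - height K' v) (PI / 4)).
    { apply (ex_derive_continuous (K := R_AbsRing) (V := R_NormedModule)).
      eexists. apply (is_derive_minus (V := R_NormedModule)); [apply Hd | apply Hd']. }
    assert (Habs : 0 < Rabs K') by (apply Rabs_pos_lt, HK0).
    assert (He : 0 < K' ^ 2 / 6 / Rabs K').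
    { apply Rdiv_lt_0_compat; lra. }
    assert (Hl := proj1 (filterlim_locally _ _) Hc (mkposreal _ He)).
    revert Hl. apply filter_imp. intros v Hv.
    apply same_surface_same_height; try assumption.
    change (Rabs (height K v - height K' v
                  - (height K (PI / 4) - height K' (PI / 4)))
            < K' ^ 2 / 6 / Rabs K') in Hv.
    rewrite !height_base, Rminus_diag, Rminus_0_r in Hv.
    apply (Rmult_lt_compat_l (Rabs K')) in Hv; [| exact Habs].
    replace (Rabs K' * (K' ^ 2 / 6 / Rabs K')) with (K' ^ 2 / 6) in Hv
      by (field; lra).
    exact Hv. }
  assert (Hp : pitch K (PI / 4) = pitch K' (PI / 4)).
  { rewrite <- (is_derive_unique _ _ _ Hd'). symmetry. apply is_derive_unique.
    apply (is_derive_ext_loc (V := R_NormedModule) (height K) _ _ _ Hloc Hd). }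
  rewrite !pitch_base in Hp by assumption.
  assert (H1 := sqrt_lt_R0 (1 - K) ltac:(lra)).
  assert (H2 := sqrt_lt_R0 (1 - K') ltac:(lra)).
  assert (Hr : sqrt (1 - K) = sqrt (1 - K')).
  { rewrite <- (Rinv_inv (sqrt (1 - K))), <- (Rinv_inv (sqrt (1 - K'))).
    f_equal. lra. }
  apply sqrt_inj in Hr; lra.
Qed.

Theorem theorem3 :
  exists H : R -> point -> Prop,
    (forall K K' : R,
        -1 < K < 1 -> K <> 0 -> -1 < K' < 1 -> K' <> 0 ->
        (forall p, H K p <-> H K' p) -> K = K') /\
    forall K : R, -1 < K < 1 -> K <> 0 ->
      properly_embedded_surface (H K) /\
      helicoid (H K) /\
      contains_x3_axis (H K) /\
      horizontal_slices_are_lines (H K) /\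
      (exists T : R, T <> 0 /\ invariant_under (sol_mul (0, 0, T)) (H K)) /\
      invariant_under rotation_x3_axis (H K) /\
      invariant_under rotation_diagonal (H K) /\
      invariant_under rotation_antidiagonal (H K).
Proof.
  exists helicoid_surface. split.
  - intros K K' HK _ HK' HK0' Heq.
    apply helicoid_surface_injective; try assumption.
    intros p; apply Heq.
  - intros K HK HK0.
    assert (HT : exists T : R, T <> 0 /\
              invariant_under (sol_mul (0, 0, T)) (helicoid_surface K)).
    { exists (height K (PI / 4 + PI)).
      split; [now apply height_period_neq_0 | now apply helicoid_translation]. }
    assert (Haxis := helicoid_axis K HK HK0).
    assert (Hlines := helicoid_slices K HK HK0).
    split; [now apply helicoid_properly_embedded |].
    split; [now split; [apply helicoid_minimal |] |].
    split; [exact Haxis |]. split; [exact Hlines |]. split; [exact HT |].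
    split; [apply helicoid_rotation_x3_axis |].
    split; [now apply helicoid_rotation_diagonal |].
    now apply helicoid_rotation_antidiagonal.
Qed.
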